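(* Let $\mathcal{P}$ be the regular icosahedron, centered at the origin and scaled so that its midsphere (the sphere touching the midpoint of every edge) is the unit sphere $\mathbb{S}^2\subset\mathbb{R}^3$. For $\delta\in[0,\pi/2]$ let $L(\delta)$ be the configuration of the thirty lines obtained from the lines containing the thirty edges of $\mathcal{P}$ by rotating each line, inside the plane tangent to $\mathbb{S}^2$ at the midpoint $m$ of that edge, about the axis through the origin and $m$ by the angle $\delta$, all lines being rotated in the same sense (counterclockwise as viewed from the tip of the axis, i.e. from outside the sphere). Let $d(\delta)$ denote the minimal distance between two distinct lines of $L(\delta)$. Then the maximum of $d(\delta)$ over $\delta\in[0,\pi/2]$ is attained at the angle $$\delta_{\max}=\arctan\bigl(\sqrt{t_0}\bigr),$$ where $t_0\simeq 0.694356$ is a root of the polynomial $5t^6-80t^5+190t^3-4t^2-84t+9$, all of whose roots are real; approximately $\delta_{\max}\simeq 0.694707$. The square of the minimal distance at $\delta_{\max}$ is approximately $d(\delta_{\max})^2\simeq 0.0429216$, and the corresponding cylinder radius $r=\frac{d(\delta_{\max})}{2-d(\delta_{\max})}$ is approximately $0.115558$.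
   Context: Each line of $L(\delta)$ is tangent to the unit sphere (at the corresponding edge midpoint). At $\delta=0$ the lines contain the edges of the icosahedron; at $\delta=\pi/2$ they contain the edges of the dual dodecahedron (with the same midsphere). The rotation is carried out so that $L(\delta)$ is invariant under the group of proper (orientation-preserving) symmetries of the icosahedron. If the lines of a configuration tangent to the unit sphere have minimal pairwise distance $d$, then congruent infinite right circular cylinders having these lines as rulings, touching the unit sphere from outside and pairwise non-overlapping, can have common radius at most $r=d/(2-d)$; this is the cylinder radius referred to in the statement. *)

(* Defs.v *)
From Stdlib Require Import Reals Lra List.
From Coquelicot Require Import Coquelicot.
Open Scope R_scope.

Definition vec := (R * R * R)%type.
Definition vx (v : vec) : R := fst (fst v).
Definition vy (v : vec) : R := snd (fst v).
Definition vz (v : vec) : R := snd v.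
Definition mkv (x y z : R) : vec := (x, y, z).
Definition vadd (a b : vec) : vec := mkv (vx a + vx b) (vy a + vy b) (vz a + vz b).
Definition vsub (a b : vec) : vec := mkv (vx a - vx b) (vy a - vy b) (vz a - vz b).
Definition vscal (s : R) (a : vec) : vec := mkv (s * vx a) (s * vy a) (s * vz a).
Definition vdot (a b : vec) : R := vx a * vx b + vy a * vy b + vz a * vz b.
Definition vcross (a b : vec) : vec :=
  mkv (vy a * vz b - vz a * vy b) (vz a * vx b - vx a * vz b) (vx a * vy b - vy a * vx b).
Definition vnorm (a : vec) : R := sqrt (vdot a a).

Definition phi : R := (1 + sqrt 5) / 2.

(** The 12 vertices of a regular icosahedron of edge length 2 centred at the
    origin: cyclic permutations of (0, +-1, +-phi).  Its midradius is phi. *)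
Definition ico_raw (i : nat) : vec :=
  match i with
  | 0 => mkv 0 1 phi      | 1 => mkv 0 1 (- phi)
  | 2 => mkv 0 (-1) phi   | 3 => mkv 0 (-1) (- phi)
  | 4 => mkv 1 phi 0      | 5 => mkv 1 (- phi) 0
  | 6 => mkv (-1) phi 0   | 7 => mkv (-1) (- phi) 0
  | 8 => mkv phi 0 1      | 9 => mkv (- phi) 0 1
  | 10 => mkv phi 0 (-1)  | _ => mkv (- phi) 0 (-1)
  end.

Definition ico_vertex (i : nat) : vec := vscal (/ phi) (ico_raw i).

(** (i, j) with i < j < 12 indexes an edge of P: the two vertices are at
    distance 2 (the edge length) in the unscaled model. *)
Definition is_edge (i j : nat) : Prop :=
  (i < j)%nat /\ (j < 12)%nat /\ vdot (vsub (ico_raw i) (ico_raw j)) (vsub (ico_raw i) (ico_raw j)) = 4.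

Definition edge_mid (i j : nat) : vec :=
  vscal (1 / 2) (vadd (ico_vertex i) (ico_vertex j)).

(** Direction of the line of edge (i,j) after rotating it by angle delta about
    the axis through 0 and m (counterclockwise seen from the tip of m, i.e.
    Rodrigues' formula with unit axis m; here u . m = 0). *)
Definition edge_dir (i j : nat) (delta : R) : vec :=
  let u := vsub (ico_vertex j) (ico_vertex i) in
  let m := edge_mid i j in
  vadd (vscal (cos delta) u) (vscal (sin delta) (vcross m u)).

Definition line := vec -> Prop.

Definition Lline (i j : nat) (delta : R) : line :=
  fun p => exists s : R, p = vadd (edge_mid i j) (vscal s (edge_dir i j delta)).

Definition line_dist (l1 l2 : line) : R :=
  real (Glb_Rbar (fun r => exists p q, l1 p /\ l2 q /\ r = vnorm (vsub p q))).

(** d(delta): minimal distance between two distinct lines of L(delta)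
    (distinct edges give distinct lines, since they touch the unit sphere at
    distinct midpoints). *)
Definition dmin (delta : R) : R :=
  real (Glb_Rbar (fun r => exists i j k l,
      is_edge i j /\ is_edge k l /\ (i, j) <> (k, l) /\
      r = line_dist (Lline i j delta) (Lline k l delta))).

Definition P6 (t : R) : R :=
  5 * t ^ 6 - 80 * t ^ 5 + 190 * t ^ 3 - 4 * t ^ 2 - 84 * t + 9.

(* Main.v *)
Require Import Defs.
From Stdlib Require Import Reals.
From Coquelicot Require Import Coquelicot.
From Stdlib Require Import Lra Lia List ZArith Bool.
Import ListNotations.
Open Scope R_scope.

(** The squared distance of two lines with direction cross product n and offset
    w is (n.w)^2 / n.n.  For the lines of L(delta), scaled by 2 phi, both n.w and
    n.n are forms in (cos delta, sin delta) over Z[phi], and only eleven pairs of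
    forms occur up to the sign of n.w.  Writing t for tan^2 delta, two kinds of
    pairs govern the minimum: one at squared distance (1-t)^2 / (1+t+t^2), the
    other at squared distance proportional to t / (a + b t + c t^2).  Their graphs
    cross at t0, a root of a quartic over Z[phi] whose norm is (1+t)^2 P6(t).  The
    second function takes at most its value at t0 on t <= t0 and on
    t >= a / (c t0), the first one on t0 <= t <= 1/t0; since a < c this covers all
    angles.  At t0 itself the other nine kinds are strictly farther apart. *)

(** * Polynomials that split over the reals *)

Fixpoint peval (p : list R) (t : R) : R :=
  match p with
  | [] => 0
  | a :: q => a + t * peval q t
  end.

(** Horner's synthetic division by [t - r], coefficients listed from the constant term up; the
    remainder is [peval p r]. *)
Fixpoint pquot (r : R) (p : list R) : list R :=
  match p with
  | [] | [_] => []
  | _ :: q => peval q r :: pquot r q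
  end.

Lemma pquot_cons2 r a b q :
  pquot r (a :: b :: q) = peval (b :: q) r :: pquot r (b :: q).
Proof. reflexivity. Qed.

Lemma peval_pquot r p t :
  peval p t = peval p r + (t - r) * peval (pquot r p) t.
Proof.
  induction p as [|a [|b q] IH]; [simpl; ring | simpl; ring |].
  rewrite pquot_cons2.
  change (peval (a :: b :: q) t) with (a + t * peval (b :: q) t).
  change (peval (a :: b :: q) r) with (a + r * peval (b :: q) r).
  cbn [peval] in IH |- *; rewrite IH; ring.
Qed.

Lemma length_pquot r p : length (pquot r p) = pred (length p).
Proof.
  induction p as [|a [|b q] IH]; [reflexivity | reflexivity |].
  rewrite pquot_cons2; cbn [length]; rewrite IH; reflexivity.
Qed.

Lemma last_pquot r p :
  (2 <= length p)%nat -> last (pquot r p) 0 = last p 0.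
Proof.
  induction p as [|a [|b [|d q]] IH]; intros Hp; cbn [length] in Hp;
    try lia; [simpl; ring |].
  rewrite pquot_cons2.
  transitivity (last (pquot r (b :: d :: q)) 0).
  - rewrite pquot_cons2; reflexivity.
  - rewrite IH by (cbn [length]; lia); reflexivity.
Qed.

(** Dividing out the first root keeps the leading coefficient, and every other root survives in the
    quotient because it differs from the first. *)
Lemma peval_distinct_roots rs p :
  length p = S (length rs) -> NoDup rs -> Forall (fun r => peval p r = 0) rs ->
  forall t, peval p t = last p 0 * fold_right (fun r y => (t - r) * y) 1 rs.
Proof.
  revert p; induction rs as [|r rs IH]; intros p Hp Hd Hr t.
  - destruct p as [|a [|b q]]; try discriminate; simpl; ring.
  - inversion Hd as [|? ? Hnin Hd']; inversion Hr as [|? ? Hr0 Hr']; subst.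
    rewrite (peval_pquot r p t), Hr0, (IH (pquot r p)), last_pquot.
    + simpl; ring.
    + simpl in Hp; lia.
    + rewrite length_pquot, Hp; reflexivity.
    + exact Hd'.
    + rewrite Forall_forall in Hr' |- *; intros s Hs.
      generalize (Hr' s Hs); rewrite (peval_pquot r p s), Hr0, Rplus_0_l.
      intros H; destruct (Rmult_integral _ _ H) as [E|E]; [|exact E].
      exfalso; apply Hnin; replace r with s by lra; exact Hs.
Qed.

Lemma P6_peval t : P6 t = peval [9; -84; -4; 190; 0; -80; 5] t.
Proof. unfold P6; simpl; ring. Qed.

Lemma P6_root_between a b :
  a < b -> P6 a * P6 b < 0 -> exists r, a < r < b /\ P6 r = 0.
Proof.
  intros Hab Hs.
  destruct (IVT_cor P6 a b) as [r [Hr Pr]]; try lra.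
  - unfold P6; apply derivable_continuous; reg.
  - exists r; split; [|exact Pr].
    assert (r <> a) by (intros ->; rewrite Pr in Hs; lra).
    assert (r <> b) by (intros ->; rewrite Pr in Hs; lra).
    lra.
Qed.

Lemma P6_splits : exists r1 r2 r3 r4 r5 r6 : R, forall t : R,
  P6 t = 5 * ((t - r1) * (t - r2) * (t - r3) * (t - r4) * (t - r5) * (t - r6)).
Proof.
  (* [P6] alternates in sign at -2, -1, 0, 1/2, 1, 2, 16 (at 16 the two leading terms cancel), so
     disjoint intervals give six distinct roots. *)
  destruct (P6_root_between (-2) (-1)) as [r1 [B1 H1]]; [lra | unfold P6; lra |].
  destruct (P6_root_between (-1) 0) as [r2 [B2 H2]]; [lra | unfold P6; lra |].
  destruct (P6_root_between 0 (1/2)) as [r3 [B3 H3]]; [lra | unfold P6; lra |].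
  destruct (P6_root_between (1/2) 1) as [r4 [B4 H4]]; [lra | unfold P6; lra |].
  destruct (P6_root_between 1 2) as [r5 [B5 H5]]; [lra | unfold P6; lra |].
  destruct (P6_root_between 2 16) as [r6 [B6 H6]]; [lra | unfold P6; lra |].
  exists r1, r2, r3, r4, r5, r6; intros t.
  rewrite P6_peval, (peval_distinct_roots [r1; r2; r3; r4; r5; r6]).
  - simpl; ring.
  - reflexivity.
  - repeat constructor; simpl; intuition lra.
  - rewrite P6_peval in *; repeat constructor; assumption.
Qed.

(** * Distance between two lines *)

(** [real] sends infinite values to 0; an element and a lower bound force the infimum to be
    finite. *)
Lemma real_Glb_Rbar_ge (E : R -> Prop) D :
  (exists x, E x) -> (forall x, E x -> D <= x) -> D <= real (Glb_Rbar E).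
Proof.
  intros [x Ex] HD; destruct (Glb_Rbar_correct E) as [Hlb Hglb].
  specialize (Hlb x Ex); specialize (Hglb (Finite D) HD).
  destruct (Glb_Rbar E); simpl in *; tauto.
Qed.

Lemma real_Glb_Rbar_le (E : R -> Prop) x :
  (forall y, E y -> 0 <= y) -> E x -> real (Glb_Rbar E) <= x.
Proof.
  intros H0 Ex; destruct (Glb_Rbar_correct E) as [Hlb Hglb].
  specialize (Hlb x Ex); specialize (Hglb (Finite 0) H0).
  destruct (Glb_Rbar E); simpl in *; tauto.
Qed.

(** Convertible with [Lline], but with free base point and direction. *)
Definition param_line (a u : vec) : line :=
  fun p => exists s, p = vadd a (vscal s u).

Lemma vdot_CauchySchwarz a b : vdot a b ^ 2 <= vdot a a * vdot b b.
Proof.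
  destruct a as [[a1 a2] a3], b as [[b1 b2] b3];
    unfold vdot, vx, vy, vz; simpl.
  (* Lagrange's identity: the two sides differ by the sum of these squares. *)
  generalize (pow2_ge_0 (a1 * b2 - a2 * b1)) (pow2_ge_0 (a1 * b3 - a3 * b1))
    (pow2_ge_0 (a2 * b3 - a3 * b2)); nra.
Qed.

(** Since n = u x v is orthogonal to both lines, n.w is the same for every difference w of a point
    of one and a point of the other; Cauchy-Schwarz then bounds the length of w from below. *)
Lemma line_dist_ge_param a u b v D :
  0 < vdot (vcross u v) (vcross u v) ->
  D ^ 2 * vdot (vcross u v) (vcross u v) <= vdot (vcross u v) (vsub a b) ^ 2 ->
  D <= line_dist (param_line a u) (param_line b v).
Proof.
  intros HS HN; apply real_Glb_Rbar_ge.
  - exists (vnorm (vsub a b)), a, b; repeat split; try exists 0;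
      destruct a as [[? ?] ?], b as [[? ?] ?];
      unfold vadd, vscal, mkv, vx, vy, vz; simpl; f_equal; [f_equal| |f_equal|]; ring.
  - intros r (p & q & [s ->] & [t ->] & ->).
    set (w := vsub (vadd a (vscal s u)) (vadd b (vscal t v))).
    assert (E : vdot (vcross u v) w = vdot (vcross u v) (vsub a b)).
    { unfold w, vdot, vcross, vsub, vadd, vscal, mkv, vx, vy, vz; simpl; ring. }
    rewrite <- E in HN.
    assert (Hw : D ^ 2 <= vdot w w).
    { apply Rmult_le_reg_r with (1 := HS).
      rewrite (Rmult_comm (vdot w w)).
      eapply Rle_trans; [exact HN | apply vdot_CauchySchwarz]. }
    (* [D] may be negative, hence the detour through its absolute value. *)
    apply Rle_trans with (Rabs D); [apply Rle_abs|].
    unfold vnorm; rewrite <- sqrt_Rsqr_abs; apply sqrt_le_1_alt.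
    unfold Rsqr; lra.
Qed.

Lemma line_dist_ge0 a u b v : 0 <= line_dist (param_line a u) (param_line b v).
Proof.
  apply real_Glb_Rbar_ge.
  - exists (vnorm (vsub (vadd a (vscal 0 u)) (vadd b (vscal 0 v)))).
    exists (vadd a (vscal 0 u)), (vadd b (vscal 0 v)).
    repeat split; exists 0; reflexivity.
  - intros r (p & q & _ & _ & ->); apply sqrt_pos.
Qed.

(* The feet of the common perpendicular realise the bound: with
   n = u x v they differ by (n.(a-b) / n.n) n. *)
Lemma line_dist_le_param a u b v D :
  0 <= D ->
  0 < vdot (vcross u v) (vcross u v) ->
  vdot (vcross u v) (vsub a b) ^ 2 <= D ^ 2 * vdot (vcross u v) (vcross u v) ->
  line_dist (param_line a u) (param_line b v) <= D.
Proof.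
  intros HD HS HN.
  set (n := vcross u v) in *; set (w := vsub a b) in *.
  (* Dotting w + s u - t v = k n with v x n and with u x n gives s and t. *)
  set (s := - vdot (vcross w v) n / vdot n n).
  set (t := - vdot (vcross w u) n / vdot n n).
  set (d := vsub (vadd a (vscal s u)) (vadd b (vscal t v))).
  assert (Ed : d = vscal (vdot n w / vdot n n) n).
  { unfold d, s, t, w, n in *; clear - HS.
    destruct a as [[a1 a2] a3], b as [[b1 b2] b3],
      u as [[u1 u2] u3], v as [[v1 v2] v3].
    unfold vdot, vcross, vsub, vadd, vscal, mkv, vx, vy, vz in *; simpl in *.
    f_equal; [f_equal|]; field; lra. }
  apply Rle_trans with (vnorm d).
  - apply real_Glb_Rbar_le.
    + intros y (p & q & _ & _ & ->); apply sqrt_pos.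
    + exists (vadd a (vscal s u)), (vadd b (vscal t v)).
      split; [exists s; reflexivity | split; [exists t; reflexivity | reflexivity]].
  - unfold vnorm; rewrite <- (sqrt_pow2 D) by exact HD.
    apply sqrt_le_1_alt; rewrite Ed.
    replace (vdot (vscal (vdot n w / vdot n n) n) (vscal (vdot n w / vdot n n) n))
      with (vdot n w ^ 2 / vdot n n).
    + apply Rmult_le_reg_r with (1 := HS).
      replace (vdot n w ^ 2 / vdot n n * vdot n n) with (vdot n w ^ 2)
        by (field; lra).
      exact HN.
    + transitivity ((vdot n w / vdot n n) ^ 2 * vdot n n); [field; lra|].
      generalize (vdot n w / vdot n n); intros k.
      unfold vdot, vscal, mkv, vx, vy, vz; simpl; ring.
Qed.

(** * The edges of the icosahedron over Z[phi] *)

Lemma phi_sqr : phi * phi = phi + 1.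
Proof.
  unfold phi; assert (H := sqrt_sqrt 5 ltac:(lra)); nra.
Qed.

Lemma phi_bounds : 1.61803 < phi < 1.61804.
Proof.
  unfold phi.
  assert (2.23606 < sqrt 5) by
    (rewrite <- (sqrt_pow2 2.23606) by lra; apply sqrt_lt_1_alt; lra).
  assert (sqrt 5 < 2.23608) by
    (rewrite <- (sqrt_pow2 2.23608) by lra; apply sqrt_lt_1_alt; lra).
  lra.
Qed.

(* The pair (a, b) stands for a + b phi. *)
Definition zphi := (Z * Z)%type.
Definition zval (z : zphi) : R := IZR (fst z) + IZR (snd z) * phi.
Definition zadd (y z : zphi) : zphi := (fst y + fst z, snd y + snd z)%Z.
Definition zopp (z : zphi) : zphi := (- fst z, - snd z)%Z.
Definition zmul (y z : zphi) : zphi :=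
  (fst y * fst z + snd y * snd z,
   fst y * snd z + snd y * fst z + snd y * snd z)%Z.

Lemma zval_add y z : zval (zadd y z) = zval y + zval z.
Proof. unfold zval, zadd; simpl; rewrite !plus_IZR; ring. Qed.

Lemma zval_opp z : zval (zopp z) = - zval z.
Proof. unfold zval, zopp; simpl; rewrite !opp_IZR; ring. Qed.

Lemma zval_mul y z : zval (zmul y z) = zval y * zval z.
Proof.
  unfold zval, zmul; simpl; rewrite !plus_IZR, !mult_IZR.
  ring [phi_sqr].
Qed.

Definition zvec := (zphi * zphi * zphi)%type.
Definition zvval (v : zvec) : vec :=
  mkv (zval (fst (fst v))) (zval (snd (fst v))) (zval (snd v)).
Definition zvadd (a b : zvec) : zvec :=
  (zadd (fst (fst a)) (fst (fst b)), zadd (snd (fst a)) (snd (fst b)),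
   zadd (snd a) (snd b)).
Definition zvscal (k : zphi) (a : zvec) : zvec :=
  (zmul k (fst (fst a)), zmul k (snd (fst a)), zmul k (snd a)).
Definition zvsub (a b : zvec) : zvec := zvadd a (zvscal (-1, 0)%Z b).
Definition zvdot (a b : zvec) : zphi :=
  zadd (zadd (zmul (fst (fst a)) (fst (fst b))) (zmul (snd (fst a)) (snd (fst b))))
    (zmul (snd a) (snd b)).
Definition zvcross (a b : zvec) : zvec :=
  let '(a1, a2, a3) := a in let '(b1, b2, b3) := b in
  (zadd (zmul a2 b3) (zopp (zmul a3 b2)), zadd (zmul a3 b1) (zopp (zmul a1 b3)),
   zadd (zmul a1 b2) (zopp (zmul a2 b1))).

Lemma zvval_add a b : zvval (zvadd a b) = vadd (zvval a) (zvval b).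
Proof. unfold zvval, zvadd, vadd; simpl; now rewrite !zval_add. Qed.

Lemma zvval_scal k a : zvval (zvscal k a) = vscal (zval k) (zvval a).
Proof. unfold zvval, zvscal, vscal; simpl; now rewrite !zval_mul. Qed.

Lemma zvval_sub a b : zvval (zvsub a b) = vsub (zvval a) (zvval b).
Proof.
  unfold zvsub; rewrite zvval_add, zvval_scal.
  unfold vadd, vscal, vsub, mkv, zval, vx, vy, vz; simpl.
  f_equal; [f_equal|]; ring.
Qed.

Lemma zval_dot a b : zval (zvdot a b) = vdot (zvval a) (zvval b).
Proof. unfold zvdot, vdot; now rewrite !zval_add, !zval_mul. Qed.

Lemma zvval_cross a b : zvval (zvcross a b) = vcross (zvval a) (zvval b).
Proof.
  destruct a as [[a1 a2] a3], b as [[b1 b2] b3].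
  unfold zvval, zvcross, vcross; cbn [fst snd].
  now rewrite !zval_add, !zval_opp, !zval_mul.
Qed.

Definition zico (i : nat) : zvec :=
  (match i with
   | 0%nat => ((0, 0), (1, 0), (0, 1))   | 1%nat => ((0, 0), (1, 0), (0, -1))
   | 2%nat => ((0, 0), (-1, 0), (0, 1))  | 3%nat => ((0, 0), (-1, 0), (0, -1))
   | 4%nat => ((1, 0), (0, 1), (0, 0))   | 5%nat => ((1, 0), (0, -1), (0, 0))
   | 6%nat => ((-1, 0), (0, 1), (0, 0))  | 7%nat => ((-1, 0), (0, -1), (0, 0))
   | 8%nat => ((0, 1), (0, 0), (1, 0))   | 9%nat => ((0, -1), (0, 0), (1, 0))
   | 10%nat => ((0, 1), (0, 0), (-1, 0)) | _ => ((0, -1), (0, 0), (-1, 0))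
   end)%Z.

Lemma zvval_ico i : zvval (zico i) = ico_raw i.
Proof.
  do 11 (destruct i as [|i];
    [unfold zvval, zval, mkv; simpl; unfold mkv; f_equal; [f_equal|]; ring|]).
  unfold zvval, zval, mkv; simpl; unfold mkv; f_equal; [f_equal|]; ring.
Qed.

Definition zsqdist (i j : nat) : zphi :=
  zvdot (zvsub (zico i) (zico j)) (zvsub (zico i) (zico j)).

Lemma zval_sqdist i j :
  zval (zsqdist i j) =
  vdot (vsub (ico_raw i) (ico_raw j)) (vsub (ico_raw i) (ico_raw j)).
Proof. unfold zsqdist; now rewrite zval_dot, zvval_sub, !zvval_ico. Qed.

Definition zeqb (y z : zphi) : bool := Z.eqb (fst y) (fst z) && Z.eqb (snd y) (snd z).

Lemma zeqb_eq y z : zeqb y z = true <-> y = z.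
Proof.
  destruct y, z; unfold zeqb; simpl.
  rewrite andb_true_iff, !Z.eqb_eq; split; [intros [-> ->]; reflexivity|].
  intros H; injection H; auto.
Qed.

(** A computed list, so that claims about all pairs of edges can be settled by evaluation; [is_edge]
    contains an equality of reals. *)
Definition edges : list (nat * nat) :=
  filter (fun e => Nat.ltb (fst e) (snd e) && zeqb (zsqdist (fst e) (snd e)) (4, 0)%Z)
    (list_prod (seq 0 12) (seq 0 12)).

(** The three values are those of an edge, of a short diagonal (4 phi^2) and of a diameter. *)
Lemma sqdist_cases i j :
  (i < j)%nat -> (j < 12)%nat ->
  In (zsqdist i j) [(4, 0); (4, 4); (8, 4)]%Z.
Proof.
  intros Hij Hj.
  assert (H : forallb (fun e => negb (Nat.ltb (fst e) (snd e)) ||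
      existsb (zeqb (zsqdist (fst e) (snd e))) [(4, 0); (4, 4); (8, 4)]%Z)
      (list_prod (seq 0 12) (seq 0 12)) = true) by (vm_compute; reflexivity).
  rewrite forallb_forall in H.
  specialize (H (i, j)); cbn [fst snd] in H.
  rewrite (proj2 (Nat.ltb_lt i j) Hij) in H.
  destruct (proj1 (existsb_exists _ _)
    (H ltac:(apply in_prod; apply in_seq; lia))) as [z [Hz Ez]].
  apply zeqb_eq in Ez; rewrite Ez; exact Hz.
Qed.

Lemma is_edge_In i j : is_edge i j -> In (i, j) edges.
Proof.
  intros (Hij & Hj & Hd); rewrite <- zval_sqdist in Hd.
  apply filter_In; split; [apply in_prod; apply in_seq; lia|].
  cbn [fst snd]; rewrite (proj2 (Nat.ltb_lt i j) Hij); apply zeqb_eq.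
  assert (P := phi_bounds).
  (* The numerical bounds on [phi] show that the other two values differ from 4. *)
  destruct (sqdist_cases i j Hij Hj) as [E | [E | [E | []]]]; rewrite <- E in *;
    [reflexivity | |]; exfalso; unfold zval in Hd; simpl in Hd; lra.
Qed.

Lemma is_edge_of_sqdist i j :
  (i < j)%nat -> (j < 12)%nat -> zsqdist i j = (4, 0)%Z -> is_edge i j.
Proof.
  intros Hij Hj E; repeat split; trivial.
  rewrite <- zval_sqdist, E; unfold zval; simpl; ring.
Qed.

(* Scaling by 2 phi clears all denominators, since 1 / phi = phi - 1. *)
Definition zmid (e : nat * nat) : zvec := zvadd (zico (fst e)) (zico (snd e)).
Definition zcosdir (e : nat * nat) : zvec :=
  zvscal (2, 0)%Z (zvsub (zico (snd e)) (zico (fst e))).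
Definition zsindir (e : nat * nat) : zvec :=
  zvscal (-1, 1)%Z
    (zvcross (zmid e) (zvsub (zico (snd e)) (zico (fst e)))).

Lemma edge_mid_zmid i j :
  edge_mid i j = vscal (/ (2 * phi)) (zvval (zmid (i, j))).
Proof.
  assert (P := phi_bounds).
  unfold zmid; cbn [fst snd]; rewrite zvval_add, !zvval_ico.
  unfold edge_mid, ico_vertex.
  unfold vadd, vscal, mkv, vx, vy, vz; simpl.
  f_equal; [f_equal|]; field; lra.
Qed.

Lemma edge_dir_zdir i j delta :
  edge_dir i j delta = vscal (/ (2 * phi))
    (vadd (vscal (cos delta) (zvval (zcosdir (i, j))))
       (vscal (sin delta) (zvval (zsindir (i, j))))).
Proof.
  assert (P := phi_bounds).
  unfold zcosdir, zsindir; cbn [fst snd].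
  rewrite !zvval_scal, zvval_cross, !zvval_sub, !zvval_ico.
  unfold edge_dir; rewrite edge_mid_zmid.
  generalize (zvval (zmid (i, j))); intros m.
  replace (zval (-1, 1)%Z) with (/ phi).
  2:{ unfold zval; simpl; apply Rmult_eq_reg_l with phi; [|lra].
      rewrite Rinv_r by lra; ring [phi_sqr]. }
  replace (zval (2, 0)%Z) with 2 by (unfold zval; simpl; ring).
  unfold ico_vertex, vcross, vsub, vadd, vscal, mkv, vx, vy, vz; simpl.
  f_equal; [f_equal|]; field; lra.
Qed.

(** * The eleven kinds of pairs of lines *)

(* The cross product n of the two scaled directions is a quadratic form in
   (cos, sin); the list holds the three coefficients of n.(m - m'), for the
   scaled midpoints m and m', followed by the five of n.n. *)
Definition pair_forms (e f : nat * nat) : list zphi :=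
  let X := zvcross (zcosdir e) (zcosdir f) in
  let Y := zvadd (zvcross (zcosdir e) (zsindir f)) (zvcross (zsindir e) (zcosdir f)) in
  let W := zvcross (zsindir e) (zsindir f) in
  let m := zvsub (zmid e) (zmid f) in
  [zvdot X m; zvdot Y m; zvdot W m;
   zvdot X X; zmul (2, 0)%Z (zvdot X Y);
   zadd (zmul (2, 0)%Z (zvdot X W)) (zvdot Y Y);
   zmul (2, 0)%Z (zvdot Y W); zvdot W W].

Definition offset_form (l : list zphi) (c s : R) : R :=
  zval (nth 0 l (0, 0)%Z) * c ^ 2 + zval (nth 1 l (0, 0)%Z) * (c * s)
  + zval (nth 2 l (0, 0)%Z) * s ^ 2.

Definition normal_form (l : list zphi) (c s : R) : R :=
  zval (nth 3 l (0, 0)%Z) * c ^ 4 + zval (nth 4 l (0, 0)%Z) * (c ^ 3 * s)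
  + zval (nth 5 l (0, 0)%Z) * (c ^ 2 * s ^ 2)
  + zval (nth 6 l (0, 0)%Z) * (c * s ^ 3) + zval (nth 7 l (0, 0)%Z) * s ^ 4.

Lemma edge_offset i j k l delta :
  vdot (vcross (edge_dir i j delta) (edge_dir k l delta))
    (vsub (edge_mid i j) (edge_mid k l)) =
  (/ (2 * phi)) ^ 3 *
  offset_form (pair_forms (i, j) (k, l)) (cos delta) (sin delta).
Proof.
  rewrite !edge_dir_zdir, !edge_mid_zmid.
  unfold offset_form, pair_forms; cbn [nth].
  rewrite !zval_dot, !zvval_add, !zvval_cross, !zvval_sub.
  generalize (zvval (zmid (i, j))) (zvval (zmid (k, l)))
    (zvval (zcosdir (i, j))) (zvval (zcosdir (k, l)))
    (zvval (zsindir (i, j))) (zvval (zsindir (k, l)))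
    (/ (2 * phi)) (cos delta) (sin delta).
  intros m m' u u' v v' h c s.
  unfold vdot, vcross, vsub, vadd, vscal, mkv, vx, vy, vz; simpl; ring.
Qed.

Lemma edge_normal i j k l delta :
  vdot (vcross (edge_dir i j delta) (edge_dir k l delta))
    (vcross (edge_dir i j delta) (edge_dir k l delta)) =
  (/ (2 * phi)) ^ 4 *
  normal_form (pair_forms (i, j) (k, l)) (cos delta) (sin delta).
Proof.
  rewrite !edge_dir_zdir.
  unfold normal_form, pair_forms; cbn [nth].
  rewrite !zval_add, !zval_mul, !zval_dot, !zvval_add, !zvval_cross.
  replace (zval (2, 0)%Z) with 2 by (unfold zval; simpl; ring).
  generalize (zvval (zcosdir (i, j))) (zvval (zcosdir (k, l)))
    (zvval (zsindir (i, j))) (zvval (zsindir (k, l)))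
    (/ (2 * phi)) (cos delta) (sin delta).
  intros u u' v v' h c s.
  unfold vdot, vcross, vsub, vadd, vscal, mkv, vx, vy, vz; simpl; ring.
Qed.

Lemma inv_2phi_pos : 0 < / (2 * phi).
Proof. assert (P := phi_bounds); apply Rinv_0_lt_compat; lra. Qed.

Lemma line_dist_edges_ge0 i j k l delta :
  0 <= line_dist (Lline i j delta) (Lline k l delta).
Proof. apply line_dist_ge0. Qed.

(** With h = 1/(2 phi), the squared offset scales by h^6 and the squared normal by h^4, which leaves
    the factor (2 phi)^2 at [D ^ 2]. *)
Lemma line_dist_edges_ge i j k l delta D :
  let F := pair_forms (i, j) (k, l) in
  0 < normal_form F (cos delta) (sin delta) ->
  (2 * phi * D) ^ 2 * normal_form F (cos delta) (sin delta)
    <= offset_form F (cos delta) (sin delta) ^ 2 ->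
  D <= line_dist (Lline i j delta) (Lline k l delta).
Proof.
  intros F HS HN; assert (P := phi_bounds); assert (H := inv_2phi_pos).
  apply line_dist_ge_param; rewrite edge_normal; fold F.
  - apply Rmult_lt_0_compat; [apply pow_lt|]; assumption.
  - rewrite edge_offset; fold F.
    apply Rmult_le_compat_l with (r := (/ (2 * phi)) ^ 6) in HN;
      [|apply pow_le; lra].
    eapply Rle_trans; [|eapply Rle_trans; [exact HN|]]; right; field; lra.
Qed.

Lemma line_dist_edges_le i j k l delta D :
  let F := pair_forms (i, j) (k, l) in
  0 <= D ->
  0 < normal_form F (cos delta) (sin delta) ->
  offset_form F (cos delta) (sin delta) ^ 2
    <= (2 * phi * D) ^ 2 * normal_form F (cos delta) (sin delta) ->
  line_dist (Lline i j delta) (Lline k l delta) <= D.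
Proof.
  intros F HD HS HN; assert (P := phi_bounds); assert (H := inv_2phi_pos).
  apply line_dist_le_param; [exact HD | |]; rewrite edge_normal; fold F.
  - apply Rmult_lt_0_compat; [apply pow_lt|]; assumption.
  - rewrite edge_offset; fold F.
    apply Rmult_le_compat_l with (r := (/ (2 * phi)) ^ 6) in HN;
      [|apply pow_le; lra].
    eapply Rle_trans; [|eapply Rle_trans; [exact HN|]]; right; field; lra.
Qed.

(** Rows in the layout of [pair_forms], complete up to [flip_offset]; the last two are the critical
    kinds. *)
Definition kinds : list (list zphi) :=
  [ [(0,0); (0,128); (0,0); (0,0); (0,0); (1024,0); (0,0); (0,0)];
    [(0,32); (64,32); (0,-32); (128,64); (-256,256); (384,0); (0,-256); (192,-64)];
    [(0,0); (0,32); (0,0); (128,64); (0,0); (384,0); (0,0); (192,-64)];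
    [(0,-32); (64,32); (0,32); (128,64); (256,-256); (384,0); (0,256); (192,-64)];
    [(-32,0); (32,0); (32,0); (192,-64); (-256,0); (0,128); (256,-256); (192,0)];
    [(0,0); (32,64); (0,0); (192,-64); (0,0); (512,128); (0,0); (192,0)];
    [(32,0); (32,0); (-32,0); (192,-64); (256,0); (0,128); (-256,256); (192,0)];
    [(-32,-32); (32,32); (32,32); (192,0); (0,-256); (128,-128); (256,0); (128,64)];
    [(32,32); (32,32); (-32,-32); (192,0); (0,256); (128,-128); (-256,0); (128,64)];
    [(0,0); (-32,32); (0,0); (192,0); (0,0); (640,-128); (0,0); (128,64)];
    [(0,32); (0,0); (0,-32); (256,0); (0,0); (256,0); (0,0); (256,0)] ]%Z.

(** The effect of reversing one of the two directions: n changes sign, so n.w does too while n.n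
    stays. The orientation of an edge is arbitrary. *)
Definition flip_offset (l : list zphi) : list zphi :=
  map zopp (firstn 3 l) ++ skipn 3 l.

(** An explicit term, so that membership in [kinds] can be decided by [vm_compute]. *)
Definition zlist_dec : forall l m : list zphi, {l = m} + {l <> m} :=
  list_eq_dec (fun y z : zphi =>
    match Z.eq_dec (fst y) (fst z), Z.eq_dec (snd y) (snd z) with
    | left p, left q => left (injective_projections y z p q)
    | right p, _ => right (fun E => p (f_equal fst E))
    | _, right q => right (fun E => q (f_equal snd E))
    end).

Lemma pair_forms_kinds e f :
  In e edges -> In f edges -> e <> f ->
  In (pair_forms e f) kinds \/ In (pair_forms e f) (map flip_offset kinds).
Proof.
  intros He Hf Hef.
  assert (H : forallb (fun p =>
      (Nat.eqb (fst (fst p)) (fst (snd p)) && Nat.eqb (snd (fst p)) (snd (snd p))) ||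
      (if in_dec zlist_dec (pair_forms (fst p) (snd p)) (kinds ++ map flip_offset kinds)
       then true else false)) (list_prod edges edges) = true)
    by (vm_compute; reflexivity).
  rewrite forallb_forall in H.
  specialize (H (e, f) (in_prod _ _ _ _ He Hf)); cbn [fst snd] in H.
  apply orb_true_iff in H; destruct H as [H | H].
  - apply andb_true_iff in H; rewrite !Nat.eqb_eq in H.
    exfalso; apply Hef; apply injective_projections; apply H.
  - apply in_app_or.
    destruct in_dec as [I | I]; [exact I | discriminate].
Qed.

(** * The two critical kinds *)

(* Vanishes exactly where the last two kinds are at the same distance. *)
Definition tie (t p : R) : R :=
  3 + 3 * p + (4 * p - 6) * t - (18 + p) * t ^ 2 + (2 * p - 6) * t ^ 3
  + (3 + 4 * p) * t ^ 4.

(* 1 - phi is the conjugate of phi, so this is the norm of tie t phi. *)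
Lemma tie_norm t : tie t phi * tie t (1 - phi) = P6 t * (1 + t) ^ 2.
Proof. unfold tie, P6; ring [phi_sqr]. Qed.

(** The norm vanishes at a root of [P6], and the conjugate factor is negative on the whole
    interval. *)
Lemma P6_tie t : 0.69 < t < 0.7 -> P6 t = 0 -> tie t phi = 0.
Proof.
  intros Ht H; generalize (tie_norm t); rewrite H, Rmult_0_l.
  intros E; destruct (Rmult_integral _ _ E) as [E' | E']; [exact E'|].
  exfalso; assert (P := phi_bounds).
  assert (H2 : 0.47 < t ^ 2 < 0.5) by nra.
  assert (H3 : 0.32 < t ^ 3 < 0.35) by nra.
  assert (H4 : 0.22 < t ^ 4 < 0.25) by nra.
  revert E'; unfold tie; nra.
Qed.

(** For t = tan^2 delta between 0 and 1, the distance of a pair of the last kind. *)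
Definition opt_dist (t : R) : R := (1 - t) / sqrt (1 + t + t ^ 2).

Lemma opt_dist_sqr t : opt_dist t ^ 2 = (1 - t) ^ 2 / (1 + t + t ^ 2).
Proof.
  assert (H : 0 < 1 + t + t ^ 2) by nra.
  assert (H1 := sqrt_lt_R0 _ H).
  unfold opt_dist; rewrite <- (sqrt_sqrt (1 + t + t ^ 2)) at 2 by lra.
  field; lra.
Qed.

Lemma opt_dist_scaled t :
  (2 * phi * opt_dist t) ^ 2 = 4 * (phi + 1) * (1 - t) ^ 2 / (1 + t + t ^ 2).
Proof.
  rewrite Rpow_mult_distr, opt_dist_sqr, <- phi_sqr; unfold Rdiv; ring.
Qed.

(** The right side is the ratio of the other critical kind; the two ratios differ by a multiple of
    [tie t phi]. *)
Lemma opt_dist_scaled_tie t :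
  0 < t -> tie t phi = 0 ->
  (2 * phi * opt_dist t) ^ 2 =
  1024 * (2 - phi) * t / (192 + (640 - 128 * phi) * t + (128 + 64 * phi) * t ^ 2).
Proof.
  intros Ht H; assert (P := phi_bounds); rewrite opt_dist_scaled.
  assert (0 < 1 + t + t ^ 2) by nra.
  assert (0 < 192 + (640 - 128 * phi) * t + (128 + 64 * phi) * t ^ 2).
  { assert (0 < (640 - 128 * phi) * t) by (apply Rmult_lt_0_compat; lra).
    assert (0 <= (128 + 64 * phi) * t ^ 2)
      by (apply Rmult_le_pos; [lra | apply pow2_ge_0]).
    lra. }
  apply Rminus_diag_uniq.
  transitivity (256 * tie t phi / ((1 + t + t ^ 2) *
    (192 + (640 - 128 * phi) * t + (128 + 64 * phi) * t ^ 2)));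
    [|rewrite H; unfold Rdiv; ring].
  unfold tie; field_simplify_eq; [ring [phi_sqr] | split; lra].
Qed.

(** * An upper bound for the minimal distance at every angle *)

Lemma dmin_le_pair i j k l delta :
  is_edge i j -> is_edge k l -> (i, j) <> (k, l) ->
  dmin delta <= line_dist (Lline i j delta) (Lline k l delta).
Proof.
  intros H1 H2 H3; apply real_Glb_Rbar_le.
  - intros y (i' & j' & k' & l' & _ & _ & _ & ->); apply line_dist_edges_ge0.
  - exists i, j, k, l; auto.
Qed.

(** One pair of each critical kind suffices. Working with forms in [C] and [T] avoids dividing by
    cos delta. *)
Lemma dmin_le_opt delta t :
  0.69 < t < 0.7 -> tie t phi = 0 -> dmin delta <= opt_dist t.
Proof.
  intros Ht H; assert (P := phi_bounds).
  assert (HD : 0 <= opt_dist t).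
  { apply Rmult_le_pos; [lra|].
    apply Rlt_le, Rinv_0_lt_compat, sqrt_lt_R0; nra. }
  set (C := cos delta ^ 2); set (T := sin delta ^ 2).
  assert (HC : 0 <= C) by apply pow2_ge_0.
  assert (HT : 0 <= T) by apply pow2_ge_0.
  assert (HCT : C + T = 1).
  { generalize (sin2_cos2 delta); unfold C, T, Rsqr; lra. }
  assert (E02 : is_edge 0 2) by (apply is_edge_of_sqdist; [lia | lia | reflexivity]).
  assert (E08 : is_edge 0 8) by (apply is_edge_of_sqdist; [lia | lia | reflexivity]).
  assert (E46 : is_edge 4 6) by (apply is_edge_of_sqdist; [lia | lia | reflexivity]).
  (* With tau = T/C, the function tau / (a + b tau + c tau^2) is invariant under tau -> a / (c tau);
     hence the two linear factors. *)
  assert (HA : 0 <= (t * C - T) * (192 * C - (128 + 64 * phi) * t * T) ->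
    dmin delta <= opt_dist t).
  { intros HX; eapply Rle_trans;
      [apply (dmin_le_pair 0 2 0 8); [exact E02 | exact E08 | discriminate]|].
    assert (ES : normal_form (pair_forms (0, 2)%nat (0, 8)%nat) (cos delta) (sin delta)
      = 192 * C ^ 2 + (640 - 128 * phi) * (C * T) + (128 + 64 * phi) * T ^ 2).
    { unfold normal_form, zval, C, T; vm_compute pair_forms; simpl; ring. }
    assert (EN : offset_form (pair_forms (0, 2)%nat (0, 8)%nat) (cos delta) (sin delta) ^ 2
      = 1024 * (2 - phi) * (C * T)).
    { unfold offset_form, zval, C, T; vm_compute pair_forms; simpl; ring [phi_sqr]. }
    assert (S0 : 0 < 192 + (640 - 128 * phi) * t + (128 + 64 * phi) * t ^ 2) by nra.
    apply line_dist_edges_le; [exact HD | |].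
    - rewrite ES.
      assert (0 <= (640 - 128 * phi) * (C * T))
        by (apply Rmult_le_pos; [lra | apply Rmult_le_pos; assumption]).
      assert (0 <= (64 * phi - 64) * T ^ 2)
        by (apply Rmult_le_pos; [lra | apply pow2_ge_0]).
      nra.
    - rewrite ES, EN, opt_dist_scaled_tie by lra.
      apply Rmult_le_reg_r with (1 := S0).
      match goal with |- _ <= ?A / ?B * ?E * ?B =>
        replace (A / B * E * B) with (A * E) by (field; lra) end.
      apply Rminus_le_0.
      match goal with |- 0 <= ?Z =>
        replace Z with (1024 * (2 - phi) *
          ((t * C - T) * (192 * C - (128 + 64 * phi) * t * T))) by ring end.
      apply Rmult_le_pos; [lra | exact HX]. }
  (* Here the invariance is under tau -> 1/tau, so the second factor vanishes at 1/t. *)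
  assert (HB : 0 <= (T - t * C) * (C - t * T) -> dmin delta <= opt_dist t).
  { intros HX; eapply Rle_trans;
      [apply (dmin_le_pair 0 2 4 6); [exact E02 | exact E46 | discriminate]|].
    assert (ES : normal_form (pair_forms (0, 2)%nat (4, 6)%nat) (cos delta) (sin delta)
      = 256 * (C ^ 2 + C * T + T ^ 2)).
    { unfold normal_form, zval, C, T; vm_compute pair_forms; simpl; ring. }
    assert (EN : offset_form (pair_forms (0, 2)%nat (4, 6)%nat) (cos delta) (sin delta) ^ 2
      = 1024 * (phi + 1) * (T - C) ^ 2).
    { unfold offset_form, zval, C, T; vm_compute pair_forms; simpl; ring [phi_sqr]. }
    assert (S0 : 0 < 1 + t + t ^ 2) by nra.
    apply line_dist_edges_le; [exact HD | |].
    - rewrite ES; nra.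
    - rewrite ES, EN, opt_dist_scaled.
      apply Rmult_le_reg_r with (1 := S0).
      match goal with |- _ <= ?A / ?B * ?E * ?B =>
        replace (A / B * E * B) with (A * E) by (field; lra) end.
      apply Rminus_le_0.
      match goal with |- 0 <= ?Z =>
        replace Z with (3072 * (phi + 1) * ((T - t * C) * (C - t * T))) by ring end.
      apply Rmult_le_pos; [lra | exact HX]. }
  destruct (Rle_lt_dec T (t * C)) as [L | L].
  - apply HA, Rmult_le_pos; [lra|].
    (* Since 0.49 * 232 < 192, the second factor is nonnegative. *)
    assert (t * T <= 0.7 * 0.7 * C) by nra.
    assert (128 + 64 * phi <= 232) by lra.
    assert (0 <= t * T) by (apply Rmult_le_pos; lra).
    nra.
  - destruct (Rle_lt_dec (t * T) C) as [L' | L'].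
    + apply HB, Rmult_le_pos; lra.
    (* Beyond 1/t both factors are nonpositive, because 192 < 128 + 64 phi. *)
    + apply HA.
      assert (0 <= t * T) by (apply Rmult_le_pos; lra).
      assert (192 * (t * T) <= (128 + 64 * phi) * (t * T))
        by (apply Rmult_le_compat_r; lra).
      rewrite <- Rmult_opp_opp; apply Rmult_le_pos; lra.
Qed.

(** * The remaining kinds at the optimal angle *)

Lemma Rmult_bounds a b c d x y :
  a < x < b -> c < y < d -> 0 <= a -> 0 <= c -> a * c < x * y < b * d.
Proof. intros; split; apply Rmult_le_0_lt_compat; lra. Qed.

(** The hypotheses of [line_dist_edges_ge], freed from cos and sin: by homogeneity of degree 4 they
    can be checked at (1, tan delta). *)
Definition separated (D : R) (l : list zphi) (c s : R) : Prop :=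
  0 < normal_form l c s /\
  (2 * phi * D) ^ 2 * normal_form l c s <= offset_form l c s ^ 2.

Lemma separated_homogeneous D l c s k :
  0 < k -> separated D l c s -> separated D l (k * c) (k * s).
Proof.
  intros Hk [H1 H2]; unfold separated.
  replace (normal_form l (k * c) (k * s)) with (k ^ 4 * normal_form l c s)
    by (unfold normal_form; ring).
  replace (offset_form l (k * c) (k * s)) with (k ^ 2 * offset_form l c s)
    by (unfold offset_form; ring).
  split; [apply Rmult_lt_0_compat; [apply pow_lt|]; assumption|].
  apply Rmult_le_compat_l with (r := k ^ 4) in H2; [|apply pow_le; lra].
  lra.
Qed.

Lemma separated_flip D l c s :
  (3 <= length l)%nat -> separated D l c s -> separated D (flip_offset l) c s.
Proof.
  destruct l as [|a [|b [|d l]]]; cbn [length]; intros Hl; try lia.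
  unfold separated.
  replace (normal_form (flip_offset (a :: b :: d :: l)) c s)
    with (normal_form (a :: b :: d :: l) c s) by reflexivity.
  replace (offset_form (flip_offset (a :: b :: d :: l)) c s)
    with (- offset_form (a :: b :: d :: l) c s).
  2:{ unfold offset_form, flip_offset; cbn -[zval zopp]; rewrite !zval_opp; ring. }
  intros [H1 H2]; split; [exact H1 | nra].
Qed.

(** 0.45 rounds up the value of (2 phi d)^2 at the optimum, about 0.4495. *)
Lemma separated_of_bounds D l c s B :
  (2 * phi * D) ^ 2 <= 0.45 ->
  0 < normal_form l c s <= B ->
  0.45 * B <= offset_form l c s ^ 2 ->
  separated D l c s.
Proof.
  intros HD HB HN; split; [lra|].
  eapply Rle_trans; [apply Rmult_le_compat_r; [lra | exact HD] | nra].
Qed.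

Lemma opt_dist_sqr_bounds t :
  0.69435583 < t < 0.69435585 -> 0.0429216 < opt_dist t ^ 2 < 0.0429217.
Proof.
  intros Ht; rewrite opt_dist_sqr; split.
  - apply Rmult_lt_reg_r with (1 + t + t ^ 2); [nra|].
    unfold Rdiv; rewrite Rmult_assoc, Rinv_l by nra; nra.
  - apply Rmult_lt_reg_r with (1 + t + t ^ 2); [nra|].
    unfold Rdiv; rewrite Rmult_assoc, Rinv_l by nra; nra.
Qed.

Ltac numeric_bound :=
  unfold normal_form, offset_form, zval; cbn [nth fst snd];
  rewrite ?pow1, ?Rmult_1_l, ?Rmult_1_r; lra.

Lemma kinds_separated x :
  0 < x -> 0.69435583 < x ^ 2 < 0.69435585 -> tie (x ^ 2) phi = 0 ->
  Forall (fun l => separated (opt_dist (x ^ 2)) l 1 x) kinds.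
Proof.
  intros Hx Ht H; assert (P := phi_bounds).
  assert (HK : (2 * phi * opt_dist (x ^ 2)) ^ 2 <= 0.45).
  { assert (B := opt_dist_sqr_bounds _ Ht).
    rewrite Rpow_mult_distr.
    replace ((2 * phi) ^ 2) with (4 * phi + 4) by ring [phi_sqr]; nra. }
  assert (B1 : 0.83328 < x < 0.83329) by nra.
  assert (B2 : 0.69435 < x ^ 2 < 0.69436) by lra.
  assert (B3 : 0.83328 * 0.69435 < x ^ 3 < 0.83329 * 0.69436)
    by (replace (x ^ 3) with (x * x ^ 2) by ring; apply Rmult_bounds; lra).
  assert (B4 : 0.69435 * 0.69435 < x ^ 4 < 0.69436 * 0.69436)
    by (replace (x ^ 4) with (x ^ 2 * x ^ 2) by ring; apply Rmult_bounds; lra).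
  (* The forms are linear in the powers of [x] and their products with [phi]; bounding each of these
     leaves only linear arithmetic. *)
  assert (Q1 := Rmult_bounds _ _ _ _ _ _ P B1 ltac:(lra) ltac:(lra)).
  assert (Q2 := Rmult_bounds _ _ _ _ _ _ P B2 ltac:(lra) ltac:(lra)).
  assert (Q3 := Rmult_bounds _ _ _ _ _ _ P B3 ltac:(lra) ltac:(lra)).
  assert (Q4 := Rmult_bounds _ _ _ _ _ _ P B4 ltac:(lra) ltac:(lra)).
  assert (numeric : forall l B m,
    0 <= m -> 0.45 * B <= m ^ 2 ->
    0 < normal_form l 1 x <= B -> m <= offset_form l 1 x ->
    separated (opt_dist (x ^ 2)) l 1 x).
  { intros l B m Hm HB HS HN; apply separated_of_bounds with (1 := HK) (2 := HS).
    eapply Rle_trans; [exact HB | apply pow_incr; lra]. }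
  unfold kinds; repeat apply Forall_cons; try apply Forall_nil.
  (* In each of these nine cases the numbers bound the normal form from above and the offset from
     below. *)
  - apply (numeric _ 712 172); [lra | lra | numeric_bound | numeric_bound].
  - apply (numeric _ 434 112); [lra | lra | numeric_bound | numeric_bound].
  - apply (numeric _ 541 43); [lra | lra | numeric_bound | numeric_bound].
  - apply (numeric _ 649 80); [lra | lra | numeric_bound | numeric_bound].
  - apply (numeric _ 20.5 16); [lra | lra | numeric_bound | numeric_bound].
  - apply (numeric _ 681 112); [lra | lra | numeric_bound | numeric_bound].
  - apply (numeric _ 630 36); [lra | lra | numeric_bound | numeric_bound].
  - apply (numeric _ 52 44); [lra | lra | numeric_bound | numeric_bound].
  - apply (numeric _ 446 95); [lra | lra | numeric_bound | numeric_bound].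
  (* The two critical kinds attain the bound with equality, this one because of the tie. *)
  - split; [numeric_bound|].
    right; rewrite opt_dist_scaled_tie by (nra || exact H).
    set (t := x ^ 2) in *.
    assert (0 < 192 + (640 - 128 * phi) * t + (128 + 64 * phi) * t ^ 2) by nra.
    transitivity (1024 * (2 - phi) * t).
    + replace (normal_form _ 1 x)
        with (192 + (640 - 128 * phi) * t + (128 + 64 * phi) * t ^ 2)
        by (unfold normal_form, zval, t; simpl; ring).
      field; lra.
    + unfold offset_form, zval, t; simpl; ring [phi_sqr].
  - split; [numeric_bound|].
    right; rewrite opt_dist_scaled.
    set (t := x ^ 2) in *.
    assert (0 < 1 + t + t ^ 2) by nra.
    transitivity (1024 * (phi + 1) * (1 - t) ^ 2).
    + replace (normal_form _ 1 x) with (256 * (1 + t + t ^ 2))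
        by (unfold normal_form, zval, t; simpl; ring).
      field; lra.
    + unfold offset_form, zval, t; simpl; ring [phi_sqr].
Qed.

Lemma dmin_atan x :
  0 < x -> 0.69435583 < x ^ 2 < 0.69435585 -> tie (x ^ 2) phi = 0 ->
  dmin (atan x) = opt_dist (x ^ 2).
Proof.
  intros Hx Ht H; apply Rle_antisym; [apply dmin_le_opt; [lra | exact H]|].
  apply real_Glb_Rbar_ge.
  - exists (line_dist (Lline 0 2 (atan x)) (Lline 0 8 (atan x))), 0%nat, 2%nat, 0%nat, 8%nat.
    repeat split; try lia; try discriminate;
      rewrite <- zval_sqdist; unfold zval; vm_compute zsqdist; simpl; ring.
  - intros y (i & j & k & l & E1 & E2 & Hne & ->).
    apply is_edge_In in E1; apply is_edge_In in E2.
    assert (K := kinds_separated x Hx Ht H); rewrite Forall_forall in K.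
    assert (HS : separated (opt_dist (x ^ 2)) (pair_forms (i, j) (k, l)) 1 x).
    { destruct (pair_forms_kinds (i, j) (k, l) E1 E2 Hne) as [I | I]; [apply K, I|].
      apply in_map_iff in I; destruct I as [m [<- I]].
      apply separated_flip; [|apply K, I].
      revert m I; apply Forall_forall; unfold kinds; repeat constructor. }
    (* This factor turns (1, x) into the cosine and sine of [atan x]. *)
    assert (Hc : 0 < / sqrt (1 + x ^ 2)) by (apply Rinv_0_lt_compat, sqrt_lt_R0; nra).
    apply (separated_homogeneous _ _ _ _ _ Hc) in HS.
    destruct HS as [HS HN].
    replace (/ sqrt (1 + x ^ 2) * 1) with (cos (atan x)) in HS, HN
      by (rewrite cos_atan; unfold Rsqr, Rdiv; simpl; rewrite !Rmult_1_r, ?Rmult_1_l; reflexivity).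
    replace (/ sqrt (1 + x ^ 2) * x) with (sin (atan x)) in HS, HN
      by (rewrite sin_atan; unfold Rsqr, Rdiv; simpl; rewrite !Rmult_1_r; ring).
    apply line_dist_edges_ge; assumption.
Qed.

(** * Numerical values *)

Ltac eval_fact_INR :=
  repeat match goal with H : context [INR (Factorial.fact (S ?n))] |- _ =>
    rewrite (fact_simpl n), mult_INR in H end;
  repeat match goal with H : context [INR (S ?n)] |- _ =>
    rewrite (INR_IZR_INZ (S n)) in H end;
  change (INR (Factorial.fact 0)) with 1 in *;
  cbn [Z.of_nat Pos.of_succ_nat Pos.succ] in *.

Lemma sin_bounds_deg13 a : 0 <= a <= 1 ->
  a - a^3/6 + a^5/120 - a^7/5040 + a^9/362880 - a^11/39916800 <= sin a
    <= a - a^3/6 + a^5/120 - a^7/5040 + a^9/362880 - a^11/39916800 + a^13/6227020800.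
Proof.
  intros Ha; assert (HP := PI2_1).
  (* Index 2 gives the alternating partial sums of degrees 11 and 13. *)
  destruct (sin_bound a 2) as [L U]; try lra.
  unfold sin_approx, sin_term in L, U.
  cbn -[pow INR Factorial.fact] in L, U.
  eval_fact_INR; lra.
Qed.

Lemma cos_bounds_deg12 a : 0 <= a <= 1 ->
  1 - a^2/2 + a^4/24 - a^6/720 + a^8/40320 - a^10/3628800 <= cos a
    <= 1 - a^2/2 + a^4/24 - a^6/720 + a^8/40320 - a^10/3628800 + a^12/479001600.
Proof.
  intros Ha; assert (HP := PI2_1).
  destruct (cos_bound a 2) as [L U]; try lra.
  unfold cos_approx, cos_term in L, U.
  cbn -[pow INR Factorial.fact] in L, U.
  eval_fact_INR; lra.
Qed.

(** By monotonicity of atan it is enough to place [x] between the tangents of the two bounds,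
    estimated by Taylor sums for sine and cosine. *)
Lemma atan_opt_bounds x :
  0 < x -> 0.69435583 < x ^ 2 < 0.69435585 -> 0.694706 < atan x < 0.694708.
Proof.
  intros Hx Ht; assert (HP := PI2_1).
  assert (Bx : 0.83328 < x < 0.833281) by nra.
  split.
  - assert (Bs := sin_bounds_deg13 0.694706 ltac:(lra)).
    assert (Bc := cos_bounds_deg12 0.694706 ltac:(lra)).
    assert (sin 0.694706 < 0.6401597) by lra.
    assert (0.7682419 < cos 0.694706) by lra.
    rewrite <- (atan_tan 0.694706) by lra; apply atan_increasing.
    unfold tan; apply Rlt_div_l; nra.
  - assert (Bs := sin_bounds_deg13 0.694708 ltac:(lra)).
    assert (Bc := cos_bounds_deg12 0.694708 ltac:(lra)).
    assert (0.6401611 < sin 0.694708) by lra.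
    assert (0.768 < cos 0.694708 < 0.7682407) by lra.
    rewrite <- (atan_tan 0.694708) by lra; apply atan_increasing.
    unfold tan; apply Rlt_div_r; nra.
Qed.

(** * The root t0 and the values at the optimal angle *)

Theorem theorem2 :
  (* all roots of the polynomial are real: it splits into linear factors over R *)
  (exists r1 r2 r3 r4 r5 r6 : R, forall t : R,
      P6 t = 5 * ((t - r1) * (t - r2) * (t - r3) * (t - r4) * (t - r5) * (t - r6))) /\
  exists t0 : R,
    P6 t0 = 0 /\ Rabs (t0 - 694356 / 1000000) < / 1000000 /\
    let dmax := atan (sqrt t0) in
    0 <= dmax <= PI / 2 /\
    (forall delta : R, 0 <= delta <= PI / 2 -> dmin delta <= dmin dmax) /\
    Rabs (dmax - 694707 / 1000000) < / 1000000 /\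
    Rabs (dmin dmax ^ 2 - 429216 / 10000000) < / 10000000 /\
    Rabs (dmin dmax / (2 - dmin dmax) - 115558 / 1000000) < / 1000000.
Proof.
  split; [exact P6_splits|].
  (* The bracket is much narrower than the accuracy claimed for t0, so that the squared distance is
     located within 10^-7. *)
  destruct (P6_root_between 0.69435583 0.69435585) as [t [Ht Pt]];
    [lra | unfold P6; lra |].
  assert (Hx : 0 < sqrt t) by (apply sqrt_lt_R0; lra).
  assert (Ex : sqrt t ^ 2 = t) by (apply pow2_sqrt; lra).
  assert (T : tie t phi = 0) by (apply P6_tie; [lra | exact Pt]).
  assert (Ed : dmin (atan (sqrt t)) = opt_dist t).
  { rewrite dmin_atan; rewrite ?Ex; auto. }
  assert (Ba : 0.694706 < atan (sqrt t) < 0.694708)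
    by (apply atan_opt_bounds; rewrite ?Ex; assumption).
  assert (B := opt_dist_sqr_bounds t Ht).
  exists t; cbv zeta; rewrite Ed; repeat split.
  - exact Pt.
  - apply Rabs_lt_between; lra.
  - lra.
  - left; apply atan_bound.
  - intros delta _; apply dmin_le_opt; [lra | exact T].
  - apply Rabs_lt_between; lra.
  - apply Rabs_lt_between; lra.
  - assert (0 <= opt_dist t).
    { apply Rmult_le_pos; [lra|].
      apply Rlt_le, Rinv_0_lt_compat, sqrt_lt_R0; nra. }
    (* Rounded square roots of the bounds on the squared distance. *)
    assert (Bd : 0.207175 < opt_dist t < 0.2071756) by nra.
    apply Rabs_lt_between; split;
      apply Rmult_lt_reg_r with (2 - opt_dist t); try lra;
      rewrite Rmult_minus_distr_r; unfold Rdiv at 1;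
      rewrite Rmult_assoc, Rinv_l by lra; lra.
Qed.
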